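(* For any $\epsilon>0$ there exist a time-homogeneous discrete-time Markov chain with finite state space $S$ and transition probabilities $P$, two states $x,y\in S$ and a positive integer $T$ such that $$\lVert P^T(x,\cdot)-P^T(y,\cdot)\rVert_{\mathrm{TV}}\ge \frac12-\epsilon$$ and such that there is a coupling $((X_t,Y_t))_{t=0}^T$ of two copies of the chain, with initial states $x$ and $y$ respectively, satisfying $$\mathbb{P}\left(X_t=Y_t\text{ for some }0\le t\le T\right)=1.$$
   Context: $P^T(x,\cdot)$ denotes the distribution of $X_T$ given $X_0=x$. For probability distributions $\mu,\nu$ on a countable set $S$, $\lVert\mu-\nu\rVert_{\mathrm{TV}}:=\sup_{A\subseteq S}|\mu(A)-\nu(A)|$. A coupling of two copies of the chain on $\{0,\dots,T\}$ with initial states $x,y$ is a process $((X_t,Y_t))_{t=0}^T$ on $S\times S$ such that $(X_t)_{t=0}^T$ and $(Y_t)_{t=0}^T$ are each Markov chains (with respect to their own natural filtrations) with transition probabilities $P$, and $X_0=x$, $Y_0=y$; the joint process is not required to be a Markov chain. *)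

(* Defs.v *)
From HB Require Import structures.
From mathcomp Require Import all_boot all_order all_algebra.
From mathcomp Require Import all_classical all_reals all_analysis.

Set Implicit Arguments.
Unset Strict Implicit.
Unset Printing Implicit Defensive.

Import Order.TTheory GRing.Theory Num.Theory.

Local Open Scope classical_set_scope.
Local Open Scope ring_scope.

Definition stochastic (R : realType) (S : finType) (P : S -> S -> R) : Prop :=
  (forall x y, 0 <= P x y) /\ (forall x, \sum_y P x y = 1).

(* [transn P n x] is the mass function of P^n(x, .); [chain_law] below shows
   that it is the law at time n of any chain started at x. *)
Fixpoint transn (R : realType) (S : finType) (P : S -> S -> R) (n : nat)
    (x z : S) : R :=
  if n is m.+1 then \sum_w transn P m x w * P w z else (x == z)%:R.

Definition tv_dist (R : realType) (S : finType) (mu nu : S -> R) : R :=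
  sup (range (fun A : {set S} =>
    `|\sum_(z in A) mu z - \sum_(z in A) nu z|)).

Definition cond_prob (R : realType) d (Omega : measurableType d)
    (Pr : probability Omega R) (A B : set Omega) : R :=
  fine (Pr (A `&` B)) / fine (Pr B).

Definition history (Omega S : Type) (X : nat -> Omega -> S) (t : nat)
    (s : nat -> S) : set Omega :=
  [set w | forall i, (i <= t)%N -> X i w = s i].

(* Only the values of X at times 0, ..., T are constrained. Since S is finite,
   the Markov property relative to the natural filtration is the elementary one
   on the atoms X_0 = s_0, ..., X_t = s_t of positive probability. *)
Definition markov_chain (R : realType) d (Omega : measurableType d)
    (Pr : probability Omega R) (S : finType) (P : S -> S -> R) (T : nat)
    (x : S) (X : nat -> Omega -> S) : Prop :=
  [/\ forall t (A : set S), (t <= T)%N -> measurable (X t @^-1` A),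
      forall w, X 0%N w = x &
      forall t (s : nat -> S) (z : S), (t < T)%N ->
        (0 < Pr (history X t s))%E ->
        cond_prob Pr [set w | X t.+1 w = z] (history X t s) = P (s t) z].

(* The joint process (X, Y) need not be Markov. *)
Definition coupling (R : realType) d (Omega : measurableType d)
    (Pr : probability Omega R) (S : finType) (P : S -> S -> R) (T : nat)
    (x y : S) (X Y : nat -> Omega -> S) : Prop :=
  markov_chain Pr P T x X /\ markov_chain Pr P T y Y.

Section ChainLaw.
Context (R : realType) d (Omega : measurableType d) (Pr : probability Omega R).
Context (S : finType) (P : S -> S -> R) (T : nat) (x : S).
Context (X : nat -> Omega -> S) (HX : markov_chain Pr P T x X).

Let path t (p : {ffun 'I_t.+1 -> S}) (i : nat) : S := p (inord i).

Let mhist t s : (t <= T)%N -> measurable (history X t s).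
Proof.
move=> tT; have [mX _ _] := HX.
have -> : history X t s = \bigcap_(i in `I_t.+1) (X i @^-1` [set s i]).
  by apply/seteqP; split => w h i /h.
by apply: bigcap_measurable => [|i /= it]; [exists 0%N | apply: mX; apply: leq_trans tT].
Qed.

Let ev (f : Omega -> S) z : set Omega := [set w | f w = z].

Let step t s z : (t < T)%N ->
  fine (Pr (ev (X t.+1) z `&` history X t s)) =
  fine (Pr (history X t s)) * P (s t) z.
Proof.
move=> tT; have [mX _ mk] := HX.
have mh := mhist s (ltnW tT).
have mz : measurable (ev (X t.+1) z) by apply: (mX _ [set z]).
have [h0|h0] := ltP 0%E (Pr (history X t s)).
  rewrite -(mk _ _ z tT h0) /cond_prob mulrC divfK //.
  by rewrite gt_eqF // fine_gt0 // h0 ltey_eq fin_num_measure.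
have e0 : Pr (history X t s) = 0%E.
  by apply/eqP; rewrite eq_le h0 measure_ge0.
rewrite e0 mul0r; suff -> : Pr (ev (X t.+1) z `&` history X t s) = 0%E by [].
apply/eqP; rewrite eq_le measure_ge0 andbT -e0.
by apply: le_measure; rewrite ?inE //; apply: measurableI.
Qed.

Let split t (A : set Omega) : (t <= T)%N -> measurable A ->
  fine (Pr A) =
  \sum_(p : {ffun 'I_t.+1 -> S}) fine (Pr (A `&` history X t (path p))).
Proof.
move=> tT mA; rewrite sum_fine; last first.
  by move=> p _; apply: fin_num_measure; apply: measurableI => //; exact: mhist.
congr fine; pose F (p : {ffun 'I_t.+1 -> S}) := A `&` history X t (path p).
have {1}-> : A = \bigcup_(p in [set: {ffun 'I_t.+1 -> S}]) F p.
  apply/seteqP; split => w; last by case=> p _ [].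
  move=> Aw; exists [ffun i : 'I_t.+1 => X i w] => //; split => // i it.
  by rewrite /path ffunE inordK.
rewrite measure_fin_bigcup.
- rewrite fsbig_finite; last exact: finite_finset.
  rewrite -[RHS]big_enum /=; apply: perm_big; apply: uniq_perm.
  + exact: finmap.fset_uniq.
  + exact: enum_uniq.
  by move=> p; rewrite mem_enum in_fset_set; [rewrite in_setT | exact: finite_finset].
- exact: finite_finset.
- move=> p q _ _ [w [[_ hp] [_ hq]]]; apply/ffunP => i.
  have := hp i; have := hq i.
  by rewrite /path inord_val -ltnS => <- // <-.
- by move=> p _; apply: measurableI => //; exact: mhist.
Qed.

Lemma chain_law t z : (t <= T)%N ->
  fine (Pr [set w | X t w = z]) = transn P t x z.
Proof.
have [mX X0 mk] := HX.
have mev u v : (u <= T)%N -> measurable (ev (X u) v).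
  by move=> uT; exact: (mX u [set v] uT).
elim: t z => [|t IH] z tT.
  rewrite /=; have [<-|xz] := eqVneq x z.
    suff -> : [set w | X 0%N w = x] = setT by rewrite probability_setT.
    by apply/seteqP; split => // w _; exact: X0.
  suff -> : [set w | X 0%N w = z] = set0 by rewrite measure0.
  by apply/seteqP; split => // w /= e; move: xz; rewrite -(X0 w) e eqxx.
rewrite /= (split (ltnW tT)); last exact: mev.
under [LHS]eq_bigr => p _ do rewrite (step (path p) z tT).
rewrite (partition_big (fun p : {ffun 'I_t.+1 -> S} => path p t) xpredT) //=.
apply: eq_bigr => w _; rewrite -IH ?(ltnW tT) //.
rewrite (split (ltnW tT)); last exact: (mev t w (ltnW tT)).
rewrite mulr_suml [RHS](bigID (fun p : {ffun 'I_t.+1 -> S} => path p t == w)) /=.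
rewrite [X in _ = _ + X]big1 ?addr0 => [|p pw]; last first.
  suff -> : [set u | X t u = w] `&` history X t (path p) = set0.
    by rewrite measure0 mul0r.
  apply/seteqP; split => // u [/= Xw /(_ t (leqnn t)) e].
  by move: pw; rewrite -e Xw eqxx.
apply: eq_bigr => p /eqP pw; rewrite pw; congr (fine (Pr _) * _).
apply/seteqP; split => u; last by case.
by move=> h; split => //=; rewrite (h t (leqnn t)).
Qed.

End ChainLaw.

(* Main.v *)
(** Let [h] be harmonic. Two absorbed simple walks on [0, n] from about [3n/4]
    and [n/4] have harmonic heights differing by about [1/2]. By gambler's ruin
    the minimum [U] of the upper walk and the maximum [V] of the lower one
    satisfy [P(U <= m) + P(V > m) >= 1] for every level [m], since
    [1/(n-m) + 1/(m+1) >= 4/(n+1)]; so their paths can be matched with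
    [U <= V], i.e. they visit a common level, at walking times [t] and [t']. To
    make these visits simultaneous, each walk first waits a delay uniform in
    [Z/N]: pairing the upper walk of delay [a] with the lower walk of delay
    [a + t - t'] preserves the uniform law, since the shift does not depend on
    [a], and it fails only when the addition wraps around, with probability
    [eta = O(1/N)].

    Finally let [x] move to the upper walk with probability [1/(1+eta)] and to
    the lower one otherwise, and let [y] do the converse. Every failed upper
    path is coupled with an independent copy of the chain of [y] which took the
    exceptional first step, so the two agree at time 1, and symmetrically for
    the failed lower paths. The marginals are right and the chains always meet,
    while the distance of the harmonic heights is only multiplied by
    [(1-eta)/(1+eta)]. *)

From HB Require Import structures.
Require Import Defs.
From mathcomp Require Import all_boot all_order all_algebra.
From mathcomp Require Import all_classical all_reals all_analysis.
From mathcomp Require Import zify ring lra.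

Set Implicit Arguments.
Unset Strict Implicit.
Unset Printing Implicit Defensive.

Import Order.TTheory GRing.Theory Num.Theory.

(** * The absorbed walk on [0, n] and its running minimum *)

(** If [u x + u (s x) > n] with [x] of rank [r], the sublevel sets at [(u x).-1] and [n - u x] have
    at most [r] and [#|T| - 1 - r] elements, against the hypothesis at [m = (u x).-1]. *)
Lemma antimonotone_matching (T : finType) (u : T -> nat) (n : nat) :
  (forall x, u x <= n) ->
  (forall m, m < n ->
     #|T| <= #|[pred x | u x <= m]| + #|[pred x | u x <= n.-1 - m]|) ->
  exists2 s : T -> T, injective s & forall x, u x + u (s x) <= n.
Proof.
move=> un hc.
pose e := sort (relpre u leq) (enum T).
have se : sorted (relpre u leq) e by apply: sort_sorted => x y; exact: leq_total.
have me x : x \in e by rewrite mem_sort mem_enum.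
have ue : uniq e by rewrite sort_uniq enum_uniq.
have ze : size e = #|T| by rewrite size_sort -cardT.
have ie x : index x e < #|T| by rewrite -ze index_mem.
have card_low x m : m < u x -> #|[pred y | u y <= m]| <= index x e.
  move=> mx; apply: (@leq_trans #|[pred y in take (index x e) e]|).
    apply: subset_leq_card; apply/fintype.subsetP => y /=; rewrite !inE => ym.
    rewrite in_take // ltnNge; apply/negP => xy.
    suff : u x <= u y by lia.
    have := @sorted_leq_nth _ (relpre u leq) (fun _ _ _ => @leq_trans _ _ _)
      (fun _ => leqnn _) x e se (index x e) (index y e).
    by rewrite !inE !index_mem !me !nth_index // => /(_ isT isT xy).
  rewrite (leq_trans (card_size _)) // size_take ze.
  by case: ifP => // /negbT; rewrite -leqNgt.
(* Exchange the ranks [r] and [#|T| - 1 - r] in the order of [u]. *)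
pose s x := nth x e (#|T|.-1 - index x e).
have ise x : index (s x) e = #|T|.-1 - index x e.
  rewrite /s index_uniq // ze; have := ie x; lia.
exists s => [x y xy|x].
  have := congr1 (index^~ e) xy; rewrite !ise => ixy.
  have : index x e = index y e by have := ie x; have := ie y; lia.
  by move/(congr1 (nth x e)); rewrite !nth_index.
rewrite leqNgt; apply/negP => lt.
have u1 := un x; have u2 := un (s x).
have l1 := @card_low x (u x).-1; have l2 := @card_low (s x) (n - u x).
have := hc (u x).-1; rewrite ise in l2.
have -> : n.-1 - (u x).-1 = n - u x by lia.
have := ie x; lia.
Qed.

Definition walk_step (n k : nat) (b : bool) : nat :=
  if (k == 0) || (n <= k) then k else if b then k.+1 else k.-1.

Fixpoint walk (n k : nat) (beta : nat -> bool) (j : nat) : nat :=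
  if j is j'.+1 then walk_step n (walk n k beta j') (beta j') else k.

Fixpoint walk_min (n k : nat) (beta : nat -> bool) (j : nat) : nat :=
  if j is j'.+1 then minn (walk_min n k beta j') (walk n k beta j) else k.

Lemma walk_ext n k beta beta' j :
  (forall i, i < j -> beta i = beta' i) -> walk n k beta j = walk n k beta' j.
Proof.
elim: j => //= j IH h; rewrite IH ?h // => i ij; apply: h; exact: ltnW.
Qed.

Lemma walk_min_ext n k beta beta' j :
  (forall i, i < j -> beta i = beta' i) ->
  walk_min n k beta j = walk_min n k beta' j.
Proof.
elim: j => //= j IH h; rewrite IH => [|i ij]; last by apply: h; exact: ltnW.
by rewrite (@walk_ext n k beta beta') ?h // => i ij; apply: h; exact: ltnW.
Qed.

Lemma walk_le n k beta j : k <= n -> walk n k beta j <= n.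
Proof. by move=> kn; elim: j => //= j; rewrite /walk_step; do !case: ifP; lia. Qed.

Lemma walk_reflect n k beta j : k <= n ->
  walk n (n - k) (negb \o beta) j = n - walk n k beta j.
Proof.
move=> kn; elim: j => //= j ->; have := @walk_le n k beta j kn.
by rewrite /walk_step /=; case: (beta j) => /= h; do !case: ifP; lia.
Qed.

Lemma walk_min_le n k beta j i : i <= j -> walk_min n k beta j <= walk n k beta i.
Proof.
elim: j => [|j IH]; first by rewrite leqn0 => /eqP ->.
rewrite leq_eqVlt => /orP[/eqP ->|]; first by rewrite /= geq_minr.
by rewrite ltnS => /IH h; rewrite /= geq_min h.
Qed.

(** A discrete intermediate value property: a walk descends by at most one per step. *)
Lemma walk_hits n k beta j L : walk_min n k beta j <= L <= k ->
  exists2 i, i <= j & walk n k beta i = L.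
Proof.
elim: j => [|j IH] /=; first by exists 0 => //=; lia.
have [h|h] := leqP (walk_min n k beta j) L.
  by case/andP => _ Lk; have [|i ij <-] := IH; [rewrite h|exists i => //; exact: leqW].
rewrite geq_min leqNgt h /= => /andP[sL Lk]; exists j.+1 => //=.
have := @walk_min_le n k beta j j (leqnn j).
by move: sL; rewrite /walk_step; do !case: ifP; lia.
Qed.

(** * Finite-time gambler's ruin *)

Section hitting_probability.
Variables (R : realFieldType) (N n i K m : nat).
Hypotheses (KN : K < N) (mi : m <= i) (i_n : i < n).
Local Open Scope ring_scope.

Let W := {ffun 'I_N.+1 -> bool}.
(* In the chain below a walk makes its first step two time units after its
   delay, whence the offset. *)
Let bits (w : W) j := w (inord j.+2).

Let flip (t : 'I_N.+1) (w : W) : W := [ffun j => w j (+) (j == t)].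

Let flipK t : involutive (flip t).
Proof. by move=> w; apply/ffunP => j; rewrite !ffunE addbK. Qed.

(** Flipping bit [t] permutes the noises, so a bit ignored by [f] acts as an independent fair
    coin. *)
Let sum_flip (t : 'I_N.+1) (f : W -> bool -> R) :
  (forall w b, f (flip t w) b = f w b) ->
  \sum_w f w (w t) = \sum_w (f w true + f w false) / 2.
Proof.
move=> fE; have e : \sum_w f w (w t) = \sum_w f w (~~ w t).
  rewrite (reindex_inj (inv_inj (flipK t))) /=.
  by apply: eq_bigr => w _; rewrite fE ffunE eqxx addbT.
rewrite -mulr_suml big_split /=.
have -> : \sum_w f w true + \sum_w f w false =
  \sum_w f w (w t) + \sum_w f w (~~ w t).
  by rewrite -!big_split; apply: eq_bigr => w _; case: (w t) => //=; rewrite addrC.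
by rewrite -e; field.
Qed.

(* A lower bound for the probability of reaching [0, m] from [k] in [r] steps:
   the ruin probability minus the expected exit time over [r + 1] (Markov). *)
Let ell r (k : R) : R := (n%:R - k) / (n%:R - m%:R)
   - (k - m%:R) * (n%:R - k) / r.+1%:R.

Let pot r (k : nat) : R := if (k <= m)%N then 1 else Num.max 0 (ell r k%:R).

Let pot_ge0 r k : 0 <= pot r k.
Proof. by rewrite /pot; case: ifP => // _; rewrite le_max lexx. Qed.

Let nm : (n%:R - m%:R : R) > 0.
Proof. by rewrite subr_gt0 ltr_nat; lia. Qed.

Let pot_ge r k : (m <= k)%N -> ell r k%:R <= pot r k.
Proof.
move=> mk; rewrite /pot; case: ifP => [km|_]; last by rewrite le_max lexx orbT.
have -> : k = m by lia.
by rewrite /ell subrr !mul0r subr0 divff // gt_eqF.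
Qed.

(** Averaging over [k + 1] and [k - 1] keeps the linear part of [ell] and lowers [q] by 1, with gain
    [(r + 2 - q) / ((r + 1) (r + 2))]. If this is negative then [ell r.+1 k <= 0], and the
    truncation at 0 suffices. *)
Let pot_step r k : (m < k <= n)%N ->
  pot r.+1 k <= (pot r (walk_step n k true) + pot r (walk_step n k false)) / 2.
Proof.
move=> /andP[mk]; rewrite leq_eqVlt => /orP[/eqP ->|kn].
  have -> : pot r.+1 n = 0 by rewrite /pot leqNgt; case: ltnP; [|lia];
    rewrite /ell subrr mulr0 !mul0r subrr maxxx.
  by rewrite divr_ge0 // addr_ge0.
rewrite /walk_step; have -> : ((k == 0) || (n <= k))%N = false by lia.
have p1 := pot_ge0 r k.+1; have p2 := pot_ge0 r k.-1.
rewrite {1}/pot ifF; last by lia.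
rewrite ge_max; apply/andP; split; first by rewrite divr_ge0 // addr_ge0.
set q : R := (k%:R - m%:R) * (n%:R - k%:R).
have r1 : (r.+1%:R : R) > 0 by rewrite ltr0n.
have r2 : (r.+2%:R : R) = r.+1%:R + 1 by rewrite -[in LHS]addn1 natrD.
have [qr|qr] := leP q r.+2%:R.
  have h1 : ell r k.+1%:R <= pot r k.+1 by apply: pot_ge; lia.
  have h2 : ell r k.-1%:R <= pot r k.-1 by apply: pot_ge; lia.
  have : ell r.+1 k%:R <= (ell r k.+1%:R + ell r k.-1%:R) / 2; last first.
    by move=> h; apply: (le_trans h); rewrite ler_pM2r ?invr_gt0 ?ltr0n //; exact: lerD.
  have -> : (k.-1%:R = k%:R - 1 :> R).
    have k0 : (0 < k)%N by lia.
    by rewrite -{2}(prednK k0) -[in RHS]addn1 natrD addrK.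
  have -> : (k.+1%:R = k%:R + 1 :> R) by rewrite -addn1 natrD.
  rewrite -subr_ge0.
  have -> : (ell r (k%:R + 1) + ell r (k%:R - 1)) / 2 - ell r.+1 k%:R =
     (r.+2%:R - q) / (r.+1%:R * r.+2%:R).
    rewrite /ell /q r2; move: (r.+1%:R) r1 (n%:R) (m%:R) nm => p p0 n' m' nm'.
    by field; rewrite !gt_eqF // ltr_wpDr.
  by rewrite divr_ge0 ?mulr_ge0 ?subr_ge0.
apply: le_trans (_ : 0 <= _); last by rewrite divr_ge0 // addr_ge0.
rewrite /ell subr_le0; apply: (@le_trans _ _ 1).
  by rewrite ler_pdivrMr // mul1r lerD2l lerN2 ler_nat ltnW.
by rewrite ler_pdivlMr ?ltr0n // mul1r ltW.
Qed.

Let tot j : R := \sum_(w : W) (if (walk_min n i (bits w) j <= m)%N then 1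
   else pot (K - j) (walk n i (bits w) j)).

Let tot_step j : (j < K)%N -> tot j <= tot j.+1.
Proof.
move=> jK; rewrite /tot; pose t : 'I_N.+1 := inord j.+2.
pose f (w : W) b := if (walk_min n i (bits w) j <= m)%N then 1
   else pot (K - j.+1) (walk_step n (walk n i (bits w) j) b).
have fE w b : f (flip t w) b = f w b.
  have e k : (k < j)%N -> bits (flip t w) k = bits w k.
    move=> kj; rewrite /bits ffunE; case: eqP => [/(congr1 val)|]; last by rewrite addbF.
    by rewrite /t /= !inordK; lia.
  by rewrite /f (walk_min_ext _ _ e) (walk_ext _ _ e).
rewrite [leRHS](eq_bigr (fun w : W => f w (w t))); last first.
  move=> w _; rewrite /f /= geq_min -/(bits w j).
  by case: (walk_min _ _ _ j <= m)%N => //=; case: ifP => // h; rewrite /pot h.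
rewrite sum_flip //; apply: ler_sum => w _; rewrite /f.
case: ifP => h; first by lra.
have -> : (K - j = (K - j.+1).+1)%N by lia.
apply: pot_step; rewrite walk_le ?andbT; last by lia.
by have := @walk_min_le n i (bits w) j j (leqnn j); lia.
Qed.

(** [tot j] is [#|W|] times the expected potential after [j] steps. It is nondecreasing in [j],
    starts from at least [#|W|] times [ell K i], and ends as the number of walks that reached
    [m]. *)
Lemma walk_min_prob :
  ((n%:R - i%:R) / (n%:R - m%:R) - (i%:R - m%:R) * (n%:R - i%:R) / K.+1%:R)
    * #|W|%:R <= #|[pred w : W | walk_min n i (bits w) K <= m]%N|%:R :> R.
Proof.
have t0K : tot 0 <= tot K.
  suff h j : (j <= K)%N -> tot 0 <= tot j by exact: h.
  elim: j => // j IH jK; apply: le_trans (tot_step jK); exact/IH/ltnW.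
have : tot K = #|[pred w : W | walk_min n i (bits w) K <= m]%N|%:R.
  rewrite -sum1_card natr_sum [RHS]big_mkcond; apply: eq_bigr => w _ /=.
  rewrite inE; case: ifP => // h; rewrite subnn /pot ifF; last first.
    by have := @walk_min_le n i (bits w) K K (leqnn K); lia.
  (* With no step left, [k - m >= 1 >= 1 / (n - m)] makes [ell] nonpositive above [m]. *)
  apply/max_idPl; set k := walk _ _ _ _.
  have kn : (k <= n)%N by apply: walk_le; lia.
  have mk : (m < k)%N.
    by have := @walk_min_le n i (bits w) K K (leqnn K); rewrite -/k; lia.
  rewrite /ell divr1 subr_le0 mulrC ler_wpM2r ?subr_ge0 ?ler_nat //.
  rewrite (@le_trans _ _ 1) //.
    by rewrite invf_le1 // -natrB ?ler1n ?subn_gt0; lia.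
  by rewrite -natrB ?ler1n ?subn_gt0 // ltnW.
move=> <-; apply: le_trans t0K; rewrite /tot /= subn0.
case: (leqP i m) => [e|mi'].
  rewrite sumr_const mulr_natr lerMn2r; apply/orP; right.
  have -> : i = m by apply/eqP; rewrite eqn_leq e mi.
  by rewrite subrr !mul0r subr0 divff // gt_eqF.
rewrite sumr_const mulr_natr lerMn2r; apply/orP; right; exact: (@pot_ge K i).
Qed.

End hitting_probability.

(** * Matching upper and lower walks at a common level *)

Section matching.
Variables (q K N : nat).
Hypotheses (q1 : 1 < q) (Kq : 32 * q ^ 3 <= K) (KN : K < N).
(** Here [n + 1 = 4 q] and [n - i = q + 1], so the ruin probabilities at the levels [m] and
    [n.-1 - m] add up to at least [(q + 1) / q]. The excess [1 / q] pays for two Markov errors of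
    [1 / (2 q)]. *)
Let n := 4 * q - 1.
Let i := 3 * q - 2.
Let W := {ffun 'I_N.+1 -> bool}.
Let bits (w : W) j := w (inord j.+2).
Let low m := #|[pred w : W | walk_min n i (bits w) K <= m]|.

Let low_ge m : m < i ->
  (((q%:R + 1) / (n - m)%:R - (2 * q%:R)^-1) * #|W|%:R <= (low m)%:R :> rat)%R.
Proof.
move=> mi; have q0 : (0 < q%:R :> rat)%R by rewrite ltr0n; lia.
have i_n : i < n by rewrite /n /i; lia.
have ni : (n%:R - i%:R = q%:R + 1 :> rat)%R.
  by rewrite -natrB; [rewrite -(natrD _ _ 1); congr (_%:R)%R|]; rewrite /n /i; lia.
apply: le_trans (@walk_min_prob rat N n i K m KN (ltnW mi) i_n).
rewrite ler_wpM2r ?ler0n // ni natrB; last exact: ltnW (ltn_trans mi i_n).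
rewrite lerD2l lerN2 -natrB; last exact: ltnW.
have h : (((i - m)%:R * (q%:R + 1)) * (2 * q%:R) <= K.+1%:R :> rat)%R.
  rewrite -(natrD _ _ 1) -!natrM ler_nat; apply: leq_trans (leqW Kq).
  have : i - m <= 4 * q by rewrite /i; lia.
  by move: (i - m) => z; nia.
by rewrite ler_pdivrMr ?ltr0n // ler_pdivlMl ?mulr_gt0 // mulrC.
Qed.

(** The bits [s w] describe the reflection of the lower walk, so heights with sum [n] are a common
    level. *)
Lemma walk_matching : exists2 s : W -> W, injective s &
  forall w, exists j j', [/\ j <= K, j' <= K &
    walk n i (bits w) j + walk n i (bits (s w)) j' = n].
Proof.
have i_n : i < n by rewrite /n /i; lia.
have mi w : walk_min n i (bits w) K <= i by exact: (@walk_min_le n i _ K 0).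
have low_full m : i <= m -> low m = #|W|.
  by move=> im; apply: eq_card => w; rewrite !inE (leq_trans (mi w)).
have low2 m : m < n -> #|W| <= low m + low (n.-1 - m).
  move=> mn; have [im|{}im] := leqP i m; first by rewrite low_full // leq_addr.
  have [im'|im'] := leqP i (n.-1 - m); first by rewrite [X in _ + X]low_full // leq_addl.
  rewrite -(@ler_nat rat) natrD.
  apply: le_trans (lerD (low_ge im) (low_ge im')).
  rewrite -mulrDl ler_peMl ?ler0n //.
  have -> : n - (n.-1 - m) = m.+1 by lia.
  have q0 : (0 < q%:R :> rat)%R by rewrite ltr0n; lia.
  set a : rat := ((n - m)%:R)%R; set b : rat := (m.+1%:R)%R.
  have a0 : (0 < a)%R by rewrite ltr0n; lia.
  have b0 : (0 < b)%R by rewrite ltr0n.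
  have ab : (a + b = 4 * q%:R)%R.
    rewrite /a /b -natrD -natrM; congr (_%:R)%R; rewrite /n; lia.
  clearbody a b.
  have amhm : (q%:R^-1 <= a^-1 + b^-1)%R.
    have -> : (a^-1 + b^-1 = 4 * q%:R / (a * b))%R by rewrite -ab; field; rewrite !gt_eqF //.
    rewrite ler_pdivlMr ?mulr_gt0 // mulrC ler_pdivrMr //.
    have := sqr_ge0 (a - b)%R; nra.
  have : ((q%:R + 1) / q%:R <= (q%:R + 1) * (a^-1 + b^-1))%R.
    by rewrite ler_wpM2l // addr_ge0 // ltW.
  have -> : ((q%:R + 1) / q%:R = 1 + q%:R^-1 :> rat)%R by field; rewrite gt_eqF.
  have -> : ((2 * q%:R)^-1 = q%:R^-1 / 2 :> rat)%R by field; rewrite gt_eqF.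
  by rewrite mulrDr; lra.
have [||s inj_s sP] := @antimonotone_matching W (fun w => walk_min n i (bits w) K) n.
- by move=> w; apply: leq_trans (ltnW i_n).
- by move=> m mn; exact: low2.
exists s => // w; have := sP w; have := mi w; have := mi (s w).
set u := walk_min _ _ (bits w) _; set v := walk_min _ _ (bits (s w)) _ => vi ui uv.
(* The level must lie in [[u, i]] for the first walk and in [[n - i, n - v]] for the second; this is
   the least such level. *)
have [|j jK ej] := @walk_hits n i (bits w) K (maxn u (n - i)).
  by rewrite -/u /i /n; lia.
have [|j' jK' ej'] := @walk_hits n i (bits (s w)) K (n - maxn u (n - i)).
  by rewrite -/v /i /n; lia.
by exists j, j'; split=> //; rewrite ej ej'; rewrite /n /i; lia.
Qed.

End matching.

(** * Markov chains on a uniform finite probability space *)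

Local Open Scope ring_scope.

Section uniform_nat.
Variables (R : realType) (n : nat).

(** The finite sample space is carried by [nat], where every set is measurable. *)
Definition uniform_nat : set nat -> \bar R :=
  msum (fun k => mscale (n.+1%:R^-1)%:nng (dirac k)) n.+1.

HB.instance Definition _ := Measure.on uniform_nat.

Lemma uniform_natE (A : set nat) :
  uniform_nat A = ((\sum_(k < n.+1) ((k : nat) \in A)%:R) / n.+1%:R)%:E.
Proof.
rewrite /uniform_nat /msum mulr_suml -sumEFin; apply: eq_bigr => k _.
transitivity ((n.+1%:R^-1)%:E * (\d_(k : nat) A : \bar R))%E; first by [].
by rewrite diracE mulrC EFinM.
Qed.

Let uniform_nat_setT : uniform_nat setT = 1%E.
Proof.
rewrite uniform_natE (eq_bigr (fun=> 1)) => [|k _]; last by rewrite in_setT.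
by rewrite sumr_const card_ord divff.
Qed.

HB.instance Definition _ :=
  Measure_isProbability.Build _ _ R uniform_nat uniform_nat_setT.

End uniform_nat.

Lemma uniform_probability (R : realType) (O : finType) (V : pred O) (o0 : O) :
  V o0 -> exists (Pr : probability nat R) (dec : nat -> O),
  forall B : pred O,
    Pr [set w | B (dec w)]%classic = (#|[pred o | V o && B o]|%:R / #|V|%:R)%:E.
Proof.
move=> Vo; have V0 : (0 < #|V|)%N by apply/card_gt0P; exists o0.
exists (@uniform_nat R #|V|.-1), (nth o0 (enum V)) => B.
rewrite [LHS]uniform_natE prednK //; congr (_ / _)%:E.
rewrite -[in RHS]sum1_card natr_sum.
rewrite (eq_bigl (fun o => (o \in V) && B o)) => [|o]; last by rewrite !inE.
rewrite big_mkcondr [RHS]big_enum_val /=.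
apply: eq_bigr => k _.
rewrite (enum_val_nth o0).
have -> : ((k : nat) \in [set w | B (nth o0 (enum V) w)]%classic) = B (nth o0 (enum V) k).
  by apply/idP/idP; rewrite inE.
by case: (B _).
Qed.

Definition history_count (O : finType) (V : pred O) (S : finType)
    (X : nat -> O -> S) (t : nat) (r : nat -> S) : nat :=
  #|[pred o | V o && [forall i : 'I_t.+1, X i o == r i]]|.

(** The conditional probability is a quotient of two counts, the larger history being [s] extended
    by [z]. *)
Lemma markov_chain_of_counts (R : realType) (O : finType) (V : pred O) (o0 : O)
    (Pr : probability nat R) (dec : nat -> O) (S : finType) (P : S -> S -> R)
    (T : nat) (x : S) (X : nat -> O -> S) :
  V o0 ->
  (forall B : pred O,
    Pr [set w | B (dec w)]%classic = (#|[pred o | V o && B o]|%:R / #|V|%:R)%:E) ->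
  (forall o, X 0%N o = x) ->
  (forall t r, (t < T)%N -> (history_count V X t.+1 r)%:R =
     (history_count V X t r)%:R * P (r t) (r t.+1)) ->
  markov_chain Pr P T x (fun t w => X t (dec w)).
Proof.
move=> Vo hPr X0 step.
have V0 : #|V|%:R != 0 :> R.
  by rewrite pnatr_eq0 -lt0n; apply/card_gt0P; exists o0.
have PrH t r : Pr (history (fun t w => X t (dec w)) t r) =
    ((history_count V X t r)%:R / #|V|%:R)%:E.
  rewrite -hPr; congr (Pr _); apply/seteqP; split => w /=.
    by move=> h; apply/forallP => i; apply/eqP/h; rewrite -ltnS.
  by move=> /forallP h i it; apply/eqP; have := h (Ordinal (it : (i < t.+1)%N)).
split => [//|w|t s z tT]; first exact: X0.
rewrite PrH lte_fin /cond_prob => h0.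
pose r j := if (j <= t)%N then s j else z.
have -> : ([set w | X t.+1 (dec w) = z] `&` history (fun t w => X t (dec w)) t s =
    history (fun t w => X t (dec w)) t.+1 r)%classic.
  apply/seteqP; split => w /=.
    case=> e h i; rewrite leq_eqVlt => /orP[/eqP ->|it]; first by rewrite /r ltnn.
    by rewrite /r -ltnS it h.
  move=> h; split; first by rewrite h // /r ltnn.
  by move=> i it; rewrite h ?(leqW it) // /r it.
rewrite !PrH /= step // /r leqnn ltnn.
have -> : history_count V X t (fun j => if (j <= t)%N then s j else z) =
    history_count V X t s.
  apply: eq_card => o; rewrite !inE; congr (_ && _); apply: eq_forallb => i.
  by rewrite -ltnS ltn_ord.
have h1 : (history_count V X t s)%:R != 0 :> R.
  by apply: contraTneq h0 => ->; rewrite mul0r ltxx.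
set h := (history_count V X t s)%:R in h1 *.
by rewrite (mulrAC h) (mulrC (h / _)) mulfK // mulf_neq0 // invr_eq0.
Qed.

(** Among weights in [[0, 1]], the indicator of [nu <= mu] maximises the sum against [mu - nu]. *)
Lemma tv_dist_ge (R : realType) (S : finType) (mu nu h : S -> R) :
  (forall z, 0 <= h z <= 1) ->
  \sum_z mu z * h z - \sum_z nu z * h z <= tv_dist mu nu.
Proof.
move=> h01; pose A : {set S} := finset (fun z => nu z <= mu z).
apply: (@le_trans _ _ `|\sum_(z in A) mu z - \sum_(z in A) nu z|).
  apply: le_trans (ler_norm _); rewrite -!sumrB [leRHS]big_mkcond.
  apply: ler_sum => z _; rewrite inE -mulrBl; have /andP[h0 h1] := h01 z.
  case: (leP (nu z) (mu z)) => le; first by rewrite ler_piMr ?subr_ge0.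
  by rewrite mulr_le0_ge0 ?subr_le0 // ltW.
apply: ub_le_sup; last by exists A.
exists (\sum_z (`|mu z| + `|nu z|)) => _ [B _ <-].
rewrite -sumrB (le_trans (ler_norm_sum _ _ _)) // [leLHS]big_mkcond.
apply: ler_sum => z _; case: ifP => _; first exact: ler_normB.
by rewrite addr_ge0.
Qed.

(** With [tv_dist_ge], this bounds the distance below by a difference of harmonic heights, whatever
    the horizon. *)
Lemma transn_harmonic (R : realType) (S : finType) (P : S -> S -> R) (h : S -> R) n x :
  (forall u, \sum_v P u v * h v = h u) -> \sum_z transn P n x z * h z = h x.
Proof.
move=> hP; elim: n => [|n IH] /=.
  rewrite (bigD1 x) //= eqxx mul1r big1 ?addr0 // => z /negbTE.
  by rewrite eq_sym => ->; rewrite mul0r.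
under eq_bigr do rewrite mulr_suml.
rewrite exchange_big -[RHS]IH; apply: eq_bigr => w _ /=.
by rewrite -[h w]hP mulr_sumr; apply: eq_bigr => z _; rewrite mulrA.
Qed.

(** * From failure probability eta to a sure meeting *)

Lemma card_reindex (T : finType) (f : T -> T) (A : pred T) :
  injective f -> #|[pred x | A (f x)]| = #|A|.
Proof. by move=> fI; rewrite -!sum1_card [RHS](reindex_inj fI). Qed.

Section noise.
Variables (S E : finType) (N : nat) (F : S -> E -> S).
Local Open Scope nat_scope.

Definition noise := {ffun 'I_N.+1 -> E}.

Fixpoint traj (s : S) (w : noise) (t : nat) : S :=
  if t is t'.+1 then F (traj s w t') (w (inord t')) else s.

Definition follows (s : S) (r : nat -> bool + S) (t : nat) : pred noise :=
  fun w => [forall i : 'I_t.+1, inr (traj s w i) == r i].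

(* [w t] is exchanged with an independent noise [e]: this shows that [w t] is
   uniform and independent of the earlier noises. *)
Let upd (t : 'I_N.+1) (we : noise * E) : noise * E :=
  ([ffun i => if i == t then we.2 else we.1 i], we.1 t).

Let updK t : involutive (upd t).
Proof.
case=> w e; congr (_, _); last by rewrite /= ffunE eqxx.
by apply/ffunP => i; rewrite !ffunE /=; case: eqP => [->|].
Qed.

Lemma traj_ext s (w w' : noise) t :
  (forall i : 'I_N.+1, i < t -> w i = w' i) -> t <= N.+1 ->
  traj s w t = traj s w' t.
Proof.
elim: t => //= t IH h tN; rewrite IH ?(ltnW tN) //; first by rewrite h // inordK.
by move=> i it; apply: h; exact: ltnW.
Qed.

Lemma followsS s r t w :
  follows s r t.+1 w = follows s r t w && (inr (traj s w t.+1) == r t.+1).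
Proof.
apply/forallP/andP => [h|[/forallP h e] i].
  split; last by have := h ord_max.
  by apply/forallP => i; have := h (widen_ord (leqnSn _) i).
have := ltn_ord i; rewrite ltnS leq_eqVlt => /orP[/eqP ->//|it].
exact: (h (Ordinal it)).
Qed.

Lemma noise_marginal t (A : pred E) :
  #|[pred w : noise | A (w t)]| * #|E| = #|[pred e | A e]| * #|{: noise}|.
Proof.
transitivity #|[predX [pred w : noise | A (w t)] & predT : pred E]|; first by rewrite cardX.
rewrite mulnC -cardX -[LHS](card_reindex _ (inv_inj (updK t))).
by apply: eq_card => -[w e]; rewrite !inE /= ffunE eqxx andbT.
Qed.

(** After the exchange, the history up to [t] depends on [w] alone and the next state on [e]
    alone. *)
Lemma follows_count s r t z : t <= N -> r t = inr z ->
  #|follows s r t.+1| * #|E| =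
  #|follows s r t| * #|[pred e | inr (F z e) == r t.+1]|.
Proof.
move=> tN rt; pose it : 'I_N.+1 := inord t.
transitivity #|[predX follows s r t.+1 & predT : pred E]|; first by rewrite cardX.
rewrite -cardX -[LHS](card_reindex _ (inv_inj (updK it))).
apply: eq_card => -[w e]; rewrite /in_mem /= /in_mem /= andbT followsS.
have e1 j : j <= t -> traj s [ffun i => if i == it then e else w i] j = traj s w j.
  move=> jt; apply: traj_ext; last by lia.
  move=> i ij; rewrite ffunE; case: eqP => // ii.
  by move: ij; rewrite ii inordK; lia.
have -> : follows s r t [ffun i => if i == it then e else w i] = follows s r t w.
  by apply: eq_forallb => i; rewrite e1 // -ltnS.
case: (boolP (follows s r t w)) => //= /forallP /(_ ord_max).
by rewrite /= e1 // rt ffunE eqxx => /eqP [->].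
Qed.

Lemma follows_inl s r t b : r t = inl b -> #|follows s r t| = 0 /\ #|follows s r t.+1| = 0.
Proof.
move=> rt; have h w : follows s r t w = false.
  by apply/negP => /forallP /(_ ord_max); rewrite /= rt.
split; apply: eq_card0 => w; first exact: h.
by have : follows s r t.+1 w = false by rewrite followsS h.
Qed.

End noise.

Section upgrade.
Variables (R : realType) (S E : finType) (N : nat) (F : S -> E -> S).
Variables (start : bool -> S) (e0 : E).
Local Notation W := (noise E N).
Variables (good : pred W) (Psi : W -> W).
Hypothesis Psi_inj : injective Psi.
Hypothesis good_meet : forall w, good w ->
  exists2 t, (t <= N.+1)%N & traj F (start true) w t = traj F (start false) (Psi w) t.

Let bad : nat := #|[pred w | ~~ good w]|.

(** With [eta = bad / #|W|], the first case has weights [1 / (1 + eta)] and [eta / (1 + eta)],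
    written as quotients of counts. *)
Definition upgrade_kernel (u v : bool + S) : R :=
  match u with
  | inl c => (#|{: W}|%:R * (v == inr (start c))%:R + bad%:R * (v == inr (start (~~ c)))%:R)
             / (#|{: W}| + bad)%:R
  | inr s => #|[pred e | inr (F s e) == v]|%:R / #|E|%:R
  end.

Let O : finType := (option bool * W * W)%type.

(* [(None, w, _)] is a successful pair; [(Some true, w, w')] pairs the failed
   path [w] with an independent path [w'] of the same start, and
   [(Some false, w, w')] the failed path [Psi w'] with [w]. Uniform measure on
   valid triples gives each exceptional start the relative weight [bad]. *)
Let valid : pred O := fun o =>
  match o.1.1 with
  | None => good o.1.2
  | Some true => ~~ good o.1.2
  | Some false => ~~ good o.2
  end.

Let seed (c : bool) (o : O) : bool * W :=
  match o.1.1 with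
  | None => (c, if c then o.1.2 else Psi o.1.2)
  | Some true => (true, if c then o.1.2 else o.2)
  | Some false => (false, if c then o.1.2 else Psi o.2)
  end.

Let process (c : bool) (t : nat) (o : O) : bool + S :=
  if t is t'.+1 then inr (traj F (start (seed c o).1) (seed c o).2 t') else inl c.

Let big_option_bool (f : option bool -> nat) :
  (\sum_k f k = f None + (f (Some true) + f (Some false)))%N.
Proof.
rewrite (bigD1 None) // (bigD1 (Some true)) //= (bigD1 (Some false)) //= big1 ?addn0 //.
by case=> [[]|].
Qed.

Let sum_pred (T : finType) (A : pred T) : (\sum_x A x = #|[pred x | A x]|)%N.
Proof.
rewrite -sum1_card [RHS]big_mkcond; apply: eq_bigr => x _.
by rewrite inE /=; case: (A x).
Qed.

Let sum_fst (A : pred W) :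
  (\sum_(w : W) \sum_(w' : W) A w = #|{: W}| * #|[pred w | A w]|)%N.
Proof.
under eq_bigr do rewrite sum_nat_const; by rewrite -big_distrr /= sum_pred.
Qed.

Let sum_snd (A : pred W) :
  (\sum_(w : W) \sum_(w' : W) A w' = #|{: W}| * #|[pred w | A w]|)%N.
Proof. by rewrite exchange_big sum_fst. Qed.

Let sum_mul (A B : pred W) :
  (\sum_(w : W) \sum_(w' : W) (A w && B w') =
   #|[pred w | A w]| * #|[pred w | B w]|)%N.
Proof.
rewrite -!sum_pred big_distrl; apply: eq_bigr => w _; rewrite big_distrr.
by apply: eq_bigr => w' _; case: (A w); case: (B w').
Qed.

Let card_split (A : pred W) :
  (#|[pred w | A w]| = #|[pred w | good w && A w]| + #|[pred w | ~~ good w && A w]|)%N.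
Proof.
rewrite -!sum_pred -big_split; apply: eq_bigr => w _ /=.
by case: (good w); case: (A w).
Qed.

Let card_Psi (A : pred W) : #|[pred w | A (Psi w)]| = #|[pred w | A w]|.
Proof. exact: card_reindex. Qed.

(** Good and failed paths of side [c] together exhaust the noises, each with a free companion. The
    exceptional start pairs a free noise with a failed path. For [c = false], [Psi] permutes the
    noises. *)
Let seed_count c (f : bool -> pred W) :
  (#|[pred o | valid o && f (seed c o).1 (seed c o).2]| =
   #|{: W}| * #|[pred w | f c w]| + bad * #|[pred w | f (~~ c) w]|)%N.
Proof.
rewrite -sum_pred /O.
have -> : (\sum_(o : O) (valid o && f (seed c o).1 (seed c o).2) =
  \sum_k \sum_w \sum_w' (valid (k, w, w') && f (seed c (k, w, w')).1 (seed c (k, w, w')).2))%N.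
  by rewrite !pair_bigA; apply: eq_bigr => -[[k w] w'].
rewrite big_option_bool /valid /seed; case: c => /=.
  rewrite (sum_fst (fun w => good w && f true w)) (sum_fst (fun w => ~~ good w && f true w)).
  rewrite addnA -mulnDr -card_split; congr (_ + _)%N.
  rewrite mulnC -sum_mul; apply: eq_bigr => w _; apply: eq_bigr => w' _; by rewrite andbC.
rewrite (sum_fst (fun w => good w && f false (Psi w))).
rewrite (sum_snd (fun w => ~~ good w && f false (Psi w))) sum_mul.
rewrite addnCA -mulnDr addnC; congr (_ + _)%N.
by rewrite -(card_Psi (f false)) (card_split (fun w => f false (Psi w))).
Qed.

Let Q_gt0 : (0 < #|{: W}|)%N.
Proof. by apply/card_gt0P; exists [ffun=> e0]. Qed.

Let card_valid : #|valid| = (#|{: W}| * (#|{: W}| + bad))%N.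
Proof.
transitivity #|[pred o | valid o && true]|.
  by apply: eq_card => o; rewrite !inE andbT.
rewrite (seed_count true (fun _ _ => true)) mulnDr; congr (_ + _)%N.
by rewrite mulnC.
Qed.

Let countS c t r : history_count valid (process c) t.+1 r =
  ((r 0%N == inl c) * (#|{: W}| * #|@follows S E N F (start c) (fun j => r j.+1) t|
   + bad * #|@follows S E N F (start (~~ c)) (fun j => r j.+1) t|))%N.
Proof.
rewrite -(seed_count c (fun b => @follows S E N F (start b) (fun j => r j.+1) t)).
rewrite /history_count -!sum_pred big_distrr; apply: eq_bigr => o _ /=.
rewrite mulnb andbCA; congr (nat_of_bool (_ && _)).
apply/forallP/andP => [h|[/eqP r0 /forallP h] i].
  split; first by have := h ord0; rewrite eq_sym.
  by apply/forallP => i; have := h (lift ord0 i).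
by case: i => [[|i] ilt]; [rewrite /= r0|exact: (h (Ordinal (ilt : (i < t.+1)%N)))].
Qed.

Let process_step c t r : (t < N.+2)%N ->
  (history_count valid (process c) t.+1 r)%:R =
  (history_count valid (process c) t r)%:R * upgrade_kernel (r t) (r t.+1).
Proof.
have E0 : #|E|%:R != 0 :> R by rewrite pnatr_eq0 -lt0n; apply/card_gt0P; exists e0.
case: t => [_|t]; last first.
  rewrite ltnS => tN; rewrite !countS !natrM -mulrA; congr (_ * _).
  case rt : (r t.+1) => [b|z].
    have [h1 h2] := @follows_inl S E N F (start c) (fun j => r j.+1) t b rt.
    have [h3 h4] := @follows_inl S E N F (start (~~ c)) (fun j => r j.+1) t b rt.
    by rewrite h1 h2 h3 h4 !muln0 mul0r.
  rewrite /= mulrA; apply/eqP; rewrite -[_ == _](inj_eq (mulIf E0)) divfK //.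
  rewrite -!natrM eqr_nat; apply/eqP.
  have h1 := @follows_count S E N F (start c) (fun j => r j.+1) t z tN rt.
  have h2 := @follows_count S E N F (start (~~ c)) (fun j => r j.+1) t z tN rt.
  by rewrite !mulnDl -!mulnA h1 h2.
have follows0 s : #|@follows S E N F s (fun j => r j.+1) 0| = ((r 1%N == inr s) * #|{: W}|)%N.
  have fE w : @follows S E N F s (fun j => r j.+1) 0 w = (r 1%N == inr s).
    by apply/forallP/eqP => [/(_ ord0)/eqP <- //|e i]; rewrite ord1 /= e.
  have [e|e] := boolP (r 1%N == inr s); rewrite ?mul1n ?mul0n.
    by apply: eq_card => w; apply: etrans (fE w) _; rewrite e.
  by apply: eq_card0 => w; apply: etrans (fE w) _; apply: negbTE.
have count0 : history_count valid (process c) 0 r =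
    ((r 0%N == inl c) * (#|{: W}| * (#|{: W}| + bad)))%N.
  rewrite -card_valid -(sum_pred valid) big_distrr /history_count -sum_pred.
  apply: eq_bigr => o _ /=; rewrite mulnb andbC; congr (nat_of_bool (_ && _)).
  by apply/forallP/eqP => [/(_ ord0)/eqP <- //|e i]; rewrite ord1 /= e.
rewrite countS count0 !follows0.
case: eqP => [->|_]; last by rewrite !mul0n mul0r.
rewrite !mul1n /= !natrM natrD !natrM natrD; field.
by rewrite -natrD pnatr_eq0 addn_eq0 negb_and -lt0n Q_gt0.
Qed.

Lemma upgrade_coupling :
  exists (d : measure_display) (Omega : measurableType d)
         (Pr : probability Omega R) (X Y : nat -> Omega -> bool + S),
    coupling Pr upgrade_kernel N.+2 (inl true) (inl false) X Y /\
    Pr [set w | exists2 t : nat, (t <= N.+2)%N & X t w = Y t w]%classic = 1%E.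
Proof.
have /card_gt0P[ o0 Vo ] : (0 < #|valid|)%N by rewrite card_valid muln_gt0 addn_gt0 Q_gt0.
have [Pr [dec hPr]] := uniform_probability R Vo.
have mk c : markov_chain Pr upgrade_kernel N.+2 (inl c) (fun t w => process c t (dec w)).
  by apply: markov_chain_of_counts Vo hPr _ _ => // t r; exact: process_step.
exists _, nat, Pr, (fun t w => process true t (dec w)), (fun t w => process false t (dec w)).
split; first by split; exact: mk.
pose B o := [exists t : 'I_N.+3, process true t o == process false t o].
have -> : [set w | exists2 t, (t <= N.+2)%N &
    process true t (dec w) = process false t (dec w)]%classic = [set w | B (dec w)]%classic.
  apply/seteqP; split => w /= => [[t tN e]|/existsP[t /eqP e]].
    by apply/existsP; exists (Ordinal (tN : (t < N.+3)%N)); rewrite /= e.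
  by exists t => //; rewrite -ltnS.
rewrite hPr; congr (_%:E).
have -> : #|[pred o | valid o && B o]| = #|valid|.
  apply: eq_card => -[[k w] w']; rewrite !inE; apply: andb_idr.
  move=> h; have {h} : valid (k, w, w') := h.
  rewrite /valid /B /= => h; apply/existsP.
  (* Failed pairs leave from the same start and agree at time 1; the others meet one unit later than
     in [good_meet], because of the added first step. *)
  case: k h => [[]|] h; try by exists (inord 1); rewrite inordK.
  have [t tN e] := good_meet h.
  by exists (inord t.+1); rewrite inordK //= e.
by rewrite divff // pnatr_eq0 -lt0n; apply/card_gt0P; exists o0.
Qed.

Lemma upgrade_stochastic : stochastic upgrade_kernel.
Proof.
have E0 : #|E|%:R != 0 :> R by rewrite pnatr_eq0 -lt0n; apply/card_gt0P; exists e0.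
split.
  by case=> [c|s] v /=; rewrite divr_ge0 // addr_ge0 // mulr_ge0.
have one (s : S) : \sum_v (v == inr s :> bool + S)%:R = 1 :> R.
  by rewrite (bigD1 (inr s)) //= eqxx big1 ?addr0 // => v /negbTE ->.
case=> [c|s] /=; rewrite -mulr_suml.
  rewrite big_split /= -!mulr_sumr !one !mulr1 -natrD divff //.
  by rewrite pnatr_eq0 addn_eq0 negb_and -lt0n Q_gt0.
rewrite -natr_sum; have -> : (\sum_(v : bool + S) #|[pred e | inr (F s e) == v]| = #|E|)%N.
  transitivity (\sum_(e : E) 1)%N; last by rewrite sum1_card.
  rewrite [RHS](partition_big (fun e => inr (F s e) : bool + S) xpredT) //=.
  by apply: eq_bigr => v _; rewrite sum1_card.
by rewrite divff.
Qed.

Lemma upgrade_harmonic (h : S -> R) :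
  (forall s, \sum_e h (F s e) = #|E|%:R * h s) ->
  let H u := match u with
    | inl c => (#|{: W}|%:R * h (start c) + bad%:R * h (start (~~ c))) / (#|{: W}| + bad)%:R
    | inr s => h s
    end in
  forall u, \sum_v upgrade_kernel u v * H v = H u.
Proof.
move=> hF H.
have E0 : #|E|%:R != 0 :> R by rewrite pnatr_eq0 -lt0n; apply/card_gt0P; exists e0.
have one (s : S) : \sum_v (v == inr s :> bool + S)%:R * H v = h s.
  rewrite (bigD1 (inr s)) //= eqxx mul1r big1 ?addr0 // => v /negbTE ->.
  by rewrite mul0r.
case=> [c|s]; rewrite [upgrade_kernel]lock /= -lock.
  under eq_bigr do rewrite /= mulrAC mulrDl -!mulrA.
  by rewrite -mulr_suml big_split -!mulr_sumr !one.
under eq_bigr do rewrite /= mulrAC.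
rewrite -mulr_suml; apply/eqP; rewrite -[_ == _](inj_eq (mulIf E0)) divfK // mulrC -hF.
rewrite [X in _ == X](partition_big (fun e => inr (F s e) : bool + S) xpredT) //=.
apply/eqP/eq_bigr => v _.
rewrite (eq_bigr (fun=> H v)) => [|e /eqP <- //].
by rewrite sumr_const mulr_natl.
Qed.

End upgrade.

(** * Walks started after a uniform cyclic delay *)

Section delayed_walk.
Variables (n i K N : nat).

(* [inl (inl l)] is the start of side [l] ([true] is the upper one),
   [inl (inr (l, c))] waits [c] more steps, [inr k] walks at level [k]. *)
Definition delayed_state : finType := (bool + bool * 'I_N.+1 + 'I_n.+1)%type.

Definition height (l : bool) : nat := if l then i else (n - i)%N.

Definition delayed_step (s : delayed_state) (e : 'I_N.+1 * bool) : delayed_state :=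
  match s with
  | inl (inl l) => inl (inr (l, e.1))
  | inl (inr (l, c)) =>
      if (c : nat) is c'.+1 then inl (inr (l, inord c')) else inr (inord (height l))
  | inr k => inr (inord (walk_step n k e.2))
  end.

Definition delayed_start (l : bool) : delayed_state := inl (inl l).

Local Notation W := (noise ('I_N.+1 * bool)%type N).
Local Notation traj := (traj delayed_step).

Definition delay (w : W) : 'I_N.+1 := (w 0).1.

(** Under these bounds, neither the shifted delay nor the indices of the bits read wrap around. *)
Definition good_delay : pred W := fun w => (K <= delay w)%N && (delay w + K + 2 <= N)%N.

(** Only the [K] smallest and [K + 2] largest delays fail, and the delay is uniform. *)
Lemma bad_delay_count :
  (#|[pred w | ~~ good_delay w]| * N.+1 <= (2 * K + 2) * #|{: W}|)%N.
Proof.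
pose A (e : 'I_N.+1 * bool) := ~~ ((K <= e.1)%N && (e.1 + K + 2 <= N)%N).
have := @noise_marginal ('I_N.+1 * bool)%type N 0 A.
rewrite [#|{: 'I_N.+1 * bool}|]card_prod card_ord card_bool => e.
have {}e : (#|[pred w | ~~ good_delay w]| * (N.+1 * 2) = #|[pred e | A e]| * #|{: W}|)%N := e.
suff : (#|[pred e | A e]| <= (2 * K + 2) * 2)%N.
  by move: #|_| #|_| #|_| e => x y z; nia.
pose B (a : 'I_N.+1) := ~~ ((K <= a)%N && (a + K + 2 <= N)%N).
have -> : #|[pred e | A e]| = (#|[pred a | B a]| * 2)%N.
  rewrite -card_bool -[#|{: bool}|](eq_card (A := predT)) // -cardX.
  by apply: eq_card => -[a b]; rewrite !inE andbT.
rewrite leq_mul2r /=.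
pose s : seq 'I_N.+1 := map inord (iota 0 K ++ iota (N - K.+1) (K + 2)).
apply: leq_trans (_ : size s <= _)%N; last by rewrite size_map size_cat !size_iota; lia.
apply: leq_trans (card_size s); apply: subset_leq_card; apply/fintype.subsetP => a.
rewrite inE /B => Ba; apply/mapP; exists (a : nat); last by rewrite inord_val.
by rewrite mem_cat !mem_iota; have := ltn_ord a; move: Ba; lia.
Qed.

Hypothesis i_n : (i <= n)%N.

Lemma height_le l : (height l <= n)%N.
Proof. by case: l; rewrite /height ?leq_subr. Qed.

Lemma traj_wait l (w : W) j : (j <= delay w)%N ->
  traj (delayed_start l) w j.+1 = inl (inr (l, inord (delay w - j)%N)).
Proof.
elim: j => [_|j IH jd].
  by rewrite /= subn0 inord_val;
  congr (inl (inr (l, (w _).1))); apply: val_inj; rewrite /= inordK.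
rewrite [LHS]/= -/(traj _ _ j.+1) IH ?(ltnW jd) //=.
rewrite inordK; last by have := ltn_ord (delay w); lia.
by have -> : (delay w - j = (delay w - j.+1).+1)%N by lia.
Qed.

(** One unit draws the delay and one enters the walk, whence the shift by 2. *)
Lemma traj_walk l (w : W) j :
  traj (delayed_start l) w (delay w + j).+2 =
  inr (inord (walk n (height l) (fun k => (w (inord (delay w + k).+2)).2) j)).
Proof.
elim: j => [|j IH].
  rewrite addn0 [LHS]/= -/(traj _ _ (delay w).+1) traj_wait // subnn /=.
  by rewrite inordK.
rewrite addnS [LHS]/= -/(traj _ _ (delay w + j).+2) IH /=.
by rewrite inordK // ltnS walk_le // height_le.
Qed.

Variables (s : {ffun 'I_N.+1 -> bool} -> {ffun 'I_N.+1 -> bool}).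
Variables (tau : {ffun 'I_N.+1 -> bool} -> nat * nat).
Hypothesis s_inj : injective s.
Hypothesis tau_le : forall w, ((tau w).1 <= K)%N /\ ((tau w).2 <= K)%N.
Hypothesis tau_meet : forall w : {ffun 'I_N.+1 -> bool},
  (walk n i (fun j => w (inord j.+2)) (tau w).1 +
   walk n i (fun j => s w (inord j.+2)) (tau w).2 = n)%N.

(** Bits are indexed cyclically from the delay, so that they can be prescribed independently of
    it. *)
Definition walk_bits (w : W) : {ffun 'I_N.+1 -> bool} := [ffun j => (w (delay w + j)).2].

Definition partner_delay (a : 'I_N.+1) (w : {ffun 'I_N.+1 -> bool}) : 'I_N.+1 :=
  a + inord (tau w).1 - inord (tau w).2.

(* The bits are negated because the lower walk is [n] minus an upper walk. *)
Definition partner (w : W) : W :=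
  let b := partner_delay (delay w) (walk_bits w) in
  [ffun t => (if t == 0 then b else (w t).1, ~~ s (walk_bits w) (t - b))].

Lemma delay_partner w : delay (partner w) = partner_delay (delay w) (walk_bits w).
Proof. by rewrite /delay ffunE eqxx. Qed.

(** The partner's bits, read from its own delay, give [walk_bits w] by injectivity of [s]; these
    give the shift, hence [delay w], and then all of [w]. *)
Lemma partner_inj : injective partner.
Proof.
move=> w w' e; have eb := congr1 delay e; rewrite !delay_partner in eb.
have es : walk_bits w = walk_bits w'.
  apply: s_inj; apply/ffunP => t.
  have /ffunP /(_ (t + partner_delay (delay w) (walk_bits w))) := e.
  by rewrite !ffunE -eb addrK => -[_ /negb_inj].
have ed : delay w = delay w'.
  by move: eb; rewrite /partner_delay es => /addIr /addIr.
apply/ffunP => t.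
have e1 : (w t).1 = (w' t).1.
  have [->//|t0] := eqVneq t 0.
  have /ffunP /(_ t) := e; by rewrite !ffunE (negbTE t0) => -[].
have e2 : (w t).2 = (w' t).2.
  have /ffunP /(_ (t - delay w)) := es.
  by rewrite !ffunE ed addrC subrK.
by case: (w t) (w' t) e1 e2 => [x y] [x' y'] /= -> ->.
Qed.

(** Without wrap-around, [delay w + (tau v).1 = delay (partner w) + (tau v).2], so the two visits to
    the common level are simultaneous. *)
Lemma partner_meet w : good_delay w ->
  exists2 t, (t <= N.+1)%N &
    traj (delayed_start true) w t = traj (delayed_start false) (partner w) t.
Proof.
case/andP => Ka aN; set v := walk_bits w; have [t1 t2] := tau_le v.
have ordD (a : 'I_N.+1) k : (a + k <= N)%N -> a + inord k = inord (a + k)%N.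
  move=> h; apply: val_inj; rewrite /= !inordK; try lia.
  by rewrite modn_small; lia.
have bE : (delay (partner w) : nat) = (delay w + (tau v).1 - (tau v).2)%N.
  rewrite delay_partner /partner_delay -/v ordD; last by lia.
  have bK : ((delay w + (tau v).1 - (tau v).2)%N < N.+1)%N by lia.
  suff -> : inord (delay w + (tau v).1)%N - inord (tau v).2 =
      inord (delay w + (tau v).1 - (tau v).2)%N :> 'I_N.+1 by rewrite inordK.
  apply/eqP; rewrite subr_eq ordD inordK //; last by lia.
  by rewrite subnK //; lia.
exists (delay w + (tau v).1).+2; first by lia.
rewrite traj_walk.
have -> : (delay w + (tau v).1 = delay (partner w) + (tau v).2)%N by lia.
rewrite traj_walk; congr (inr (inord _)).
rewrite (@walk_ext n i _ (fun j => v (inord j.+2))); last first.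
  by move=> j jt; rewrite /v ffunE ordD; [rewrite !addnS|lia].
rewrite /height (@walk_ext n (n - i) _ (negb \o (fun j => s v (inord j.+2)))); last first.
  move=> j jt; rewrite /= ffunE /= -delay_partner; congr (~~ (s v _)).
  have -> : (delay (partner w) + j).+2 = (delay (partner w) + j.+2)%N by rewrite !addnS.
  by rewrite -ordD; [rewrite addrC addKr|lia].
by rewrite walk_reflect //; have := tau_meet v; lia.
Qed.

End delayed_walk.

(** * The harmonic height of the delayed walk *)

Section delayed_harmonic.
Variables (R : realType) (n i N : nat).
Hypothesis i_n : (i <= n)%N.

Definition delayed_height (s : delayed_state n N) : R :=
  match s with
  | inl (inl l) => (height n i l)%:R / n%:R
  | inl (inr (l, _)) => (height n i l)%:R / n%:R
  | inr k => k%:R / n%:R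
  end.

Lemma delayed_height_bounds s : (0 < n)%N -> 0 <= delayed_height s <= 1.
Proof.
move=> n_gt0.
have h m : (m <= n)%N -> 0 <= (m%:R / n%:R : R) <= 1.
  by move=> mn; rewrite divr_ge0 //= ler_pdivrMr ?ltr0n // mul1r ler_nat.
case: s => [[l|[l c]]|k] /=; apply: h; rewrite ?height_le //.
by rewrite -ltnS.
Qed.

Lemma delayed_height_harmonic (s : delayed_state n N) :
  \sum_e delayed_height (delayed_step i s e) = #|{: 'I_N.+1 * bool}|%:R * delayed_height s.
Proof.
have const (x : R) : \sum_(e : 'I_N.+1 * bool) x = #|{: 'I_N.+1 * bool}|%:R * x.
  by rewrite sumr_const mulr_natl.
case: s => [[l|[l [[|c] cN]]]|k] /=; rewrite ?const //.
  by rewrite inordK // ltnS height_le.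
rewrite -(pair_bigA _ (fun a b => (inord (walk_step n k b) : 'I_n.+1)%:R / n%:R)) /=.
under eq_bigr do rewrite big_bool /=.
rewrite sumr_const card_prod card_ord card_bool natrM -[LHS]mulr_natl -mulrA; congr (_ * _).
have kn := ltn_ord k; rewrite !inordK; try by rewrite /walk_step; do !case: ifP; lia.
rewrite -mulrDl mulrA; congr (_ / _); rewrite -natrD -natrM; congr _%:R.
by rewrite /walk_step; do !case: ifP; lia.
Qed.

End delayed_harmonic.

(** * Choice of parameters and conclusion *)

Unset Implicit Arguments.
Set Strict Implicit.
Set Printing Implicit Defensive.
Local Open Scope classical_set_scope.

Theorem theorem6p2 (R : realType) (eps : R) :
  0 < eps ->
  exists (S : finType) (P : S -> S -> R) (x y : S) (T : nat),
    [/\ stochastic P,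
        (0 < T)%N,
        tv_dist (transn P T x) (transn P T y) >= 1 / 2 - eps &
        exists (d : measure_display) (Omega : measurableType d)
               (Pr : probability Omega R) (X Y : nat -> Omega -> S),
          coupling Pr P T x y X Y /\
          Pr [set w | exists2 t : nat, (t <= T)%N & X t w = Y t w] = 1%E].
Proof.
move=> eps0.
(* The heights of the two starts will differ by [(2 q - 3) / (4 q - 1) >= 1 / 2 - 1 / q]. *)
have [q q1 qe] : exists2 q, (1 < q)%N & q%:R^-1 <= eps / 2.
  exists (Num.bound (2 / eps)).+2 => //.
  rewrite -[eps / 2]invrK lef_pV2 ?posrE ?invr_gt0 ?divr_gt0 //.
  rewrite invf_div (le_trans (ltW (archi_boundP _))) ?divr_ge0 ?(ltW eps0) //.
  by rewrite ler_nat ltnW.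
pose K := (32 * q ^ 3)%N; pose n := (4 * q - 1)%N; pose i := (3 * q - 2)%N.
(* This bounds [eta] by [eps / 4], whence [(1 - eta) / (1 + eta) >= 1 - eps / 2]. *)
have [N KN Ne] : exists2 N, (K < N)%N & (2 * K + 2)%:R / N.+1%:R <= eps / 4.
  exists (Num.bound ((2 * K + 2)%:R / (eps / 4)) + K).+1; first by lia.
  rewrite ler_pdivrMr ?ltr0n // -ler_pdivrMl ?divr_gt0 // mulrC.
  rewrite (le_trans (ltW (archi_boundP _))) ?divr_ge0 ?(ltW eps0) //.
  by rewrite ler_nat; do 2 apply: leqW; exact: leq_addr.
have n0 : (0 < n)%N by rewrite /n; lia.
have i_n : (i <= n)%N by rewrite /n /i; lia.
have [s s_inj meet] := @walk_matching q K N q1 (leqnn _) KN.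
have /choice[tau tauP] : forall w : {ffun 'I_N.+1 -> bool}, exists jj : nat * nat,
    ((jj.1 <= K)%N /\ (jj.2 <= K)%N) /\
    (walk n i (fun j => w (inord j.+2)) jj.1 +
     walk n i (fun j => s w (inord j.+2)) jj.2 = n)%N.
  by move=> w; have [j [j' [jK jK' e]]] := meet w; exists (j, j').
have tau_le w := (tauP w).1; have tau_meet w := (tauP w).2.
pose E : finType := ('I_N.+1 * bool)%type.
pose e0 : E := (ord0, true).
pose F := @delayed_step n i N; pose start := @delayed_start n N.
pose good := @good_delay K N.
have Psi_inj := partner_inj s_inj (tau := tau).
have good_meet w := @partner_meet n i K N i_n s tau tau_le tau_meet w.
pose P := @upgrade_kernel R _ E N F start good.
exists _, P, (inl true), (inl false), N.+2; split => //.
- exact: (@upgrade_stochastic R _ E N F start e0 good).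
- pose h := @delayed_height R n i N.
  pose Q : R := #|{: noise E N}|%:R; pose l : R := #|[pred w | ~~ good w]|%:R.
  pose H u := match u with
    | inl c => (Q * h (start c) + l * h (start (~~ c))) / (Q + l)
    | inr s => h s
    end.
  have HP u : \sum_v P u v * H v = H u.
    have := @upgrade_harmonic R _ E N F start e0 good h
      (@delayed_height_harmonic R n i N i_n) u.
    by rewrite natrD.
  have Q0 : 0 < Q by rewrite ltr0n; apply/card_gt0P; exists [ffun=> e0].
  have l0 : 0 <= l by rewrite ler0n.
  have h01 u : 0 <= h u <= 1 := delayed_height_bounds R i_n u n0.
  have H01 u : 0 <= H u <= 1.
    case: u => [c|u] /=; last exact: h01.
    have /andP[a0 a1] := h01 (start c); have /andP[b0 b1] := h01 (start (~~ c)).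
    rewrite divr_ge0 ?addr_ge0 ?mulr_ge0 ?(ltW Q0) //= ler_pdivrMr ?ltr_wpDr // mul1r.
    by rewrite lerD // ler_piMr // ltW.
  apply: le_trans (tv_dist_ge _ _ H01); rewrite !transn_harmonic // /=.
  have lQ : l <= eps / 4 * Q.
    apply: (@le_trans _ _ ((2 * K + 2)%:R / N.+1%:R * Q)); last by rewrite ler_pM2r.
    rewrite mulrAC ler_pdivlMr ?ltr0n // -!natrM ler_nat.
    exact: bad_delay_count.
  set a := h (start true); set b := h (start false).
  have -> : (Q * a + l * b) / (Q + l) - (Q * b + l * a) / (Q + l) =
      (a - b) * ((Q - l) / (Q + l)).
    by field; rewrite gt_eqF // ltr_wpDr.
  have q2 : 2 <= q%:R :> R by rewrite ler_nat.
  have nE : n%:R = 4 * q%:R - 1 :> R by rewrite natrB ?natrM //; lia.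
  have iE : i%:R = 3 * q%:R - 2 :> R by rewrite natrB ?natrM //; lia.
  have ab : a - b = (2 * q%:R - 3) / (4 * q%:R - 1).
    by rewrite /a /b /h /= -mulrBl (natrB _ i_n) nE iE; congr (_ / _); ring.
  have d0 : 0 < 4 * q%:R - 1 :> R by lra.
  have ab1 : a - b <= 1 by rewrite ab ler_pdivrMr //; lra.
  have ab2 : 1 / 2 - q%:R^-1 <= a - b.
    have uq : q%:R^-1 * q%:R = 1 :> R by rewrite mulVf // pnatr_eq0; lia.
    have u1 : q%:R^-1 <= 1 :> R by rewrite invf_le1; lra.
    rewrite ab ler_pdivlMr //; nra.
  have Ql : 0 < Q + l by rewrite ltr_wpDr.
  have r1 : 1 - eps / 2 <= (Q - l) / (Q + l) by rewrite ler_pdivlMr //; nra.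
  have r2 : (Q - l) / (Q + l) <= 1 by rewrite ler_pdivrMr //; lra.
  (* As [a - b <= 1] and [r <= 1], the product is at least [(a - b) - (1 - r)]: each loss is at most
     [eps / 2]. *)
  move: ((Q - l) / (Q + l)) r1 r2 => r r1 r2; nra.
- exact: (@upgrade_coupling R _ E N F start e0 good _ Psi_inj good_meet).
Qed.
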